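(* For any integers $a\ge 1$ and $n\ge 1$, the metallic cube $\Pi^a_n$ is (isomorphic to) an induced subgraph of some Fibonacci cube $\Gamma_m$ and, hence, of some hypercube.
   Context: For integers $a\ge 1$ and $n\ge 0$, let $\mathcal{S}^a_n$ be the set of all words $\alpha_1\cdots\alpha_n$ of length $n$ over the alphabet $\{0,1,\dots,a\}$ such that the letter $a$ appears only immediately after a letter $0$ (so $\alpha_1\ne a$, and $\alpha_i=a$ implies $\alpha_{i-1}=0$). The metallic cube $\Pi^a_n$ is the simple graph with vertex set $\mathcal{S}^a_n$ in which two vertices $\alpha,\beta$ are adjacent if and only if $\sum_{k=1}^n|\alpha_k-\beta_k|=1$, i.e. one is obtained from the other by replacing a single letter $k$ by $k+1$, $0\le k\le a-1$. The hypercube $Q_m$ is the graph whose vertices are all binary strings of length $m$, two of them being adjacent if and only if they differ in exactly one position. The Fibonacci cube $\Gamma_m$ is the subgraph of $Q_m$ induced by the binary strings of length $m$ without two consecutive ones. *)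

(* Defs.v *)
From mathcomp Require Import all_boot ssrint.

Set Implicit Arguments.
Unset Strict Implicit.
Unset Printing Implicit Defensive.

Record sgraph := SGraph {
  vertex :> finType;
  adj : rel vertex;
  adj_sym : symmetric adj;
  adj_irrefl : irreflexive adj
}.

Definition isomorphic (G H : sgraph) : Prop :=
  exists2 f : G -> H, bijective f & forall x y : G, adj (f x) (f y) = adj x y.

Section Induced.
Variables (G : sgraph) (S : {set G}).

Definition induced_adj : rel {x : G | x \in S} :=
  fun x y => adj (val x) (val y).

Lemma induced_adj_sym : symmetric induced_adj.
Proof. by move=> x y; apply: adj_sym. Qed.

Lemma induced_adj_irrefl : irreflexive induced_adj.
Proof. by move=> x; apply: adj_irrefl. Qed.

Definition induced : sgraph := SGraph induced_adj_sym induced_adj_irrefl.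

End Induced.

Definition is_induced_subgraph (G H : sgraph) : Prop :=
  exists S : {set H}, isomorphic G (induced S).

Section Hypercube.
Variable m : nat.

Definition hypercube_adj : rel (m.-tuple bool) :=
  fun x y => #|[set i | tnth x i != tnth y i]| == 1.

Lemma hypercube_adj_sym : symmetric hypercube_adj.
Proof.
move=> x y; rewrite /hypercube_adj; congr (#|pred_of_set _| == 1).
by apply/setP=> i; rewrite !inE eq_sym.
Qed.

Lemma hypercube_adj_irrefl : irreflexive hypercube_adj.
Proof.
move=> x; rewrite /hypercube_adj (_ : [set i | _] = set0) ?cards0 //.
by apply/setP=> i; rewrite !inE eqxx.
Qed.

Definition hypercube : sgraph := SGraph hypercube_adj_sym hypercube_adj_irrefl.

Definition fibonacci_strings : {set hypercube} :=
  [set w : m.-tuple bool |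
    [forall i : 'I_m, forall j : 'I_m, (j == i.+1 :> nat) ==> ~~ (tnth w i && tnth w j)]].

Definition fibonacci_cube : sgraph := induced fibonacci_strings.

End Hypercube.

Section MetallicCube.
Variables a n : nat.

(* The letter 0 is ord0 and the letter a is ord_max in 'I_a.+1. *)
Definition metallic_word (w : n.-tuple 'I_a.+1) : bool :=
  [forall i : 'I_n, (tnth w i == ord_max) ==>
    [exists j : 'I_n, (i == j.+1 :> nat) && (tnth w j == ord0)]].

Definition metallic_adj : rel {w : n.-tuple 'I_a.+1 | metallic_word w} :=
  fun x y =>
    \sum_(k < n) `|tnth (val x) k - tnth (val y) k|%N == 1.

Lemma metallic_adj_sym : symmetric metallic_adj.
Proof.
move=> x y; rewrite /metallic_adj; congr (_ == 1).
by apply: eq_bigr => k _; rewrite distnC.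
Qed.

Lemma metallic_adj_irrefl : irreflexive metallic_adj.
Proof.
by move=> x; rewrite /metallic_adj big1 // => k _; rewrite distnn.
Qed.

Definition metallic_cube : sgraph :=
  SGraph metallic_adj_sym metallic_adj_irrefl.

End MetallicCube.

(* Main.v *)
Require Import Defs.
From mathcomp Require Import all_boot.
From mathcomp Require Import ssrint.

(** The thermometer code sends a letter [k <= a] to the [a]-bit string
    [1^k 0^(a-k)], and the codes of [k] and [l] differ in exactly [|k - l|]
    positions.  Coding a metallic word letter by letter therefore turns the
    sum of the [|x_k - y_k|] into a Hamming distance
    ([thermometer_isometry]); in particular words at distance 1, and only they,
    go to adjacent vertices, so the metallic cube is an induced subgraph of the
    hypercube [Q_(n*a)].

    Every hypercube is in turn an induced subgraph of a Fibonacci cube: writing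
    a 0 after each bit of a string separates its ones and leaves Hamming
    distances unchanged ([dilute_isometry]).  Composing the two codes embeds the
    metallic cube in a Fibonacci cube. *)

Set Implicit Arguments.
Unset Strict Implicit.
Unset Printing Implicit Defensive.

Lemma embedding_is_induced_subgraph (G H : sgraph) (f : G -> H) :
  injective f -> (forall x y, adj (f x) (f y) = adj x y) ->
  is_induced_subgraph G H.
Proof.
move=> f_inj f_adj; exists [set f x | x in G].
have fP x : f x \in [set f z | z in G] by apply: imset_f.
exists (fun x => exist _ (f x) (fP x) : induced [set f z | z in G]) => //.
apply: inj_card_bij; first by move=> x y [] /f_inj.
by rewrite card_sig card_imset.
Qed.

Definition hamming m (x y : m.-tuple bool) : nat :=
  #|[set i | tnth x i != tnth y i]|.

Lemma hamming_eq0 m (x y : m.-tuple bool) : hamming x y = 0 -> x = y.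
Proof.
move/eqP; rewrite cards_eq0 => /eqP/setP xy.
by apply: eq_from_tnth => i; have := xy i; rewrite !inE => /negbFE/eqP.
Qed.

Lemma hammingxx m (x : m.-tuple bool) : hamming x x = 0.
Proof. by apply: eq_card0 => i; rewrite !inE eqxx. Qed.

Lemma sum_ltn_ord a u : u <= a -> \sum_(j < a) (j < u) = u.
Proof.
move=> le_ua; rewrite -big_mkcond /= (big_ord_narrow le_ua).
by rewrite sum1_card card_ord.
Qed.

(** For [u <= v] the code of [v] consists of the ones of the code of [u]
    together with the positions where the two codes differ, so counting ones
    gives [v = u + d]. *)
Lemma thermometer_letter_distance a u v : u <= a -> v <= a ->
  \sum_(j < a) ((j < u) != (j < v)) = `|u - v|%N.
Proof.
wlog le_uv : u v / u <= v => [IH le_ua le_va|le_ua le_va].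
  case/orP: (leq_total u v) => [/IH|/IH]; first exact.
  by rewrite distnC => <- //; apply: eq_bigr => j _; rewrite eq_sym.
rewrite distnEr //; apply/eqP; rewrite -(eqn_add2l u) subnKC //; apply/eqP.
rewrite -{1}(sum_ltn_ord le_ua) -big_split -[RHS](sum_ltn_ord le_va) /=.
apply: eq_bigr => j _; have [lt_ju|_] := ltnP j u; last by case: (j < v).
by rewrite (leq_trans lt_ju le_uv).
Qed.

Definition thermometer a n (w : n.-tuple 'I_a.+1) :
    #|{: 'I_n * 'I_a}|.-tuple bool :=
  [tuple (enum_val i).2 < tnth w (enum_val i).1 | i < #|{: 'I_n * 'I_a}|].

(** Letter by letter instance of [thermometer_letter_distance], once the
    positions are listed as pairs (letter, bit of its code). *)
Lemma thermometer_isometry a n (x y : n.-tuple 'I_a.+1) :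
  hamming (thermometer x) (thermometer y) =
    \sum_(k < n) `|tnth x k - tnth y k|%N.
Proof.
transitivity
  (\sum_(p : 'I_n * 'I_a) ((p.2 < tnth x p.1) != (p.2 < tnth y p.1))).
  rewrite /hamming -sum1dep_card big_mkcond /=.
  rewrite [RHS](reindex _ (onW_bij _ (@enum_val_bij ('I_n * 'I_a)%type))) /=.
  by apply: eq_bigr => i _; rewrite !tnth_mktuple.
rewrite -(pair_bigA _ (fun (k : 'I_n) (j : 'I_a) =>
  ((j < tnth x k) != (j < tnth y k)) : nat)) /=.
apply: eq_bigr => k _.
by rewrite thermometer_letter_distance // -ltnS ltn_ord.
Qed.

Lemma thermometer_inj a n : injective (@thermometer a n).
Proof.
move=> x y fxy; have := hammingxx (thermometer x).
rewrite {2}fxy thermometer_isometry => /eqP; rewrite sum_nat_eq0 => /forallP xy.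
by apply: eq_from_tnth => k; apply/val_inj/eqP; rewrite -distn_eq0; apply: xy.
Qed.

Lemma metallic_cube_in_hypercube a n :
  is_induced_subgraph (metallic_cube a n)
                      (hypercube #|{: 'I_n * 'I_a}|).
Proof.
apply: (@embedding_is_induced_subgraph (metallic_cube a n) (hypercube _)
          (fun w => thermometer (val w))) => [x y /thermometer_inj/val_inj //|x y].
by congr (_ == 1); apply: thermometer_isometry.
Qed.

Definition dilute m (w : m.-tuple bool) : m.*2.-tuple bool :=
  [tuple ~~ odd i && nth false w i./2 | i < m.*2].

Lemma dilute_fibonacci m (w : m.-tuple bool) :
  dilute w \in fibonacci_strings m.*2.
Proof.
rewrite inE; apply/forallP => i; apply/forallP => j; apply/implyP => /eqP ij.
by rewrite !tnth_mktuple ij /=; case: (odd i); rewrite //= andbF.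
Qed.

(** The odd positions always carry 0, so two diluted strings can differ only at
    the positions [2i], which carry the original bits. *)
Lemma dilute_isometry m (x y : m.-tuple bool) :
  hamming (dilute x) (dilute y) = hamming x y.
Proof.
have dbl_lt (i : 'I_m) : i.*2 < m.*2 by rewrite ltn_double.
pose dbl i := Ordinal (dbl_lt i).
have dbl_inj : injective dbl.
  by move=> i j /(congr1 val) /= /double_inj/val_inj.
rewrite /hamming -[RHS](card_imset _ dbl_inj).
congr (#|pred_of_set _|); apply/setP => p.
rewrite inE !tnth_mktuple; apply/idP/imsetP => [|[i]].
  have lt_pm : p./2 < m by rewrite ltn_half_double.
  case: (boolP (odd p)) => //= even_p xy; exists (Ordinal lt_pm).
    by rewrite inE !(tnth_nth false).
  by apply: val_inj; rewrite /= even_halfK.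
by rewrite inE !(tnth_nth false) => xy ->; rewrite /= odd_double doubleK.
Qed.

Lemma dilute_inj m : injective (@dilute m).
Proof.
move=> x y fxy; apply: hamming_eq0.
by rewrite -dilute_isometry fxy hammingxx.
Qed.

Lemma hypercube_in_fibonacci_cube m :
  is_induced_subgraph (hypercube m) (fibonacci_cube m.*2).
Proof.
apply: (@embedding_is_induced_subgraph (hypercube m) (fibonacci_cube _)
          (fun w => exist _ (dilute w) (dilute_fibonacci w))) => [x y|x y].
  by move/(congr1 val)/dilute_inj.
by congr (_ == 1); apply: dilute_isometry.
Qed.

Lemma is_induced_subgraph_trans (G H K : sgraph) :
  is_induced_subgraph G H -> is_induced_subgraph H K -> is_induced_subgraph G K.
Proof.
move=> [S [f /bij_inj f_inj f_adj]] [T [g /bij_inj g_inj g_adj]].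
apply: (@embedding_is_induced_subgraph G K (fun x => val (g (val (f x))))).
  by move=> x y /val_inj/g_inj/val_inj/f_inj.
by move=> x y; rewrite -f_adj; apply: g_adj.
Qed.

Theorem theorem5 (a n : nat) (ha : 1 <= a) (hn : 1 <= n) :
  (exists m : nat, is_induced_subgraph (metallic_cube a n) (fibonacci_cube m)) /\
  (exists m : nat, is_induced_subgraph (metallic_cube a n) (hypercube m)).
Proof.
split; last by eexists; apply: metallic_cube_in_hypercube.
eexists; apply: is_induced_subgraph_trans (metallic_cube_in_hypercube a n) _.
exact: hypercube_in_fibonacci_cube.
Qed.
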